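(* Let $b>4$ be a real number and let $K$ be a positive integer with $K^2<b$. Let \[ \mathcal{K}=\left\{\sum_{n=1}^{\infty}\frac{1}{d_n b^n} : d_n\in\{1,2,\dots,K\}\text{ for every } n\in\mathbb{N}\right\}. \] Then \[ \dim_{\mathcal{H}}(\mathcal{K})\geq \frac{\log K}{\log b}. \]
   Context: $\dim_{\mathcal{H}}$ denotes Hausdorff dimension of a subset of $\mathbb{R}$. The set $\mathcal{K}$ is the set of all real numbers obtained from the series as the sequence $(d_n)_{n\ge1}$ ranges over all sequences with each $d_n\in\{1,\dots,K\}$. *)

(* Defs.v *)
From mathcomp Require Import all_boot all_order all_algebra.
From mathcomp Require Import all_classical all_reals all_analysis.
Set Implicit Arguments.
Unset Strict Implicit.
Unset Printing Implicit Defensive.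
Import Order.TTheory GRing.Theory Num.Theory.
Import numFieldNormedType.Exports.
Local Open Scope classical_set_scope.
Local Open Scope ring_scope.

Section Hausdorff.
Context {R : realType}.
Implicit Types (E A : set R) (U : nat -> set R) (s delta : R).

(* The element 0 is added because ereal_sup set0 = -oo; thus diam set0 = 0. *)
Definition diam A : \bar R :=
  ereal_sup (0%E |` [set z | exists x y, [/\ A x, A y & z = `|x - y|%:E]]).

(* [diam A] to the power [s].  Since x `^ 0 = 1 for every x, the empty set is
   singled out: it must not contribute to a cover when s = 0. *)
Definition diam_pow s A : \bar R :=
  if pselect (A = set0) then 0%E else (diam A `^ s)%E.

(* Finite covers are included, because the U n may be empty. *)
Definition delta_cover delta E U : Prop :=
  (forall n, diam (U n) <= delta%:E)%E /\ E `<=` \bigcup_n U n.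

Definition hausdorff_premeasure s delta E : \bar R :=
  ereal_inf [set (\sum_(0 <= n <oo) diam_pow s (U n))%E
            | U in delta_cover delta E].

(* The supremum over delta > 0 is the limit as delta tends to 0, since
   [hausdorff_premeasure] is nonincreasing in delta. *)
Definition hausdorff_measure s E : \bar R :=
  ereal_sup [set hausdorff_premeasure s delta E | delta in [set d : R | 0 < d]].

Definition hausdorff_dim E : \bar R :=
  ereal_inf [set s%:E | s in [set s : R | 0 <= s /\ hausdorff_measure s E = 0%E]].

End Hausdorff.

(* The value d 0 plays no role: digits are indexed from 1. *)
Definition reciprocal_digit_set (R : realType) (b : R) (K : nat) : set R :=
  [set x | exists d : nat -> nat,
     (forall n, (1 <= n)%N -> (1 <= d n <= K)%N) /\
     \sum_(1 <= n < N) ((d n)%:R * b ^+ n)^-1 @[N --> \oo] --> x].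

(* Main.v *)
(** Sending y in [0, 1[ with base-K digits e_1, e_2, ... to the sum of the
    1 / ((e_n + 1) b^n) gives a map F into the set.  If the digits of y and z
    first differ at n, then |y - z| <= K^(1-n); and since (K - 1)^2 < b - 1,
    the n-th term dominates the later ones, so |F y - F z| >= c b^(-n) with
    c > 0.  Hence |y - z| <= C |F y - F z|^t with t = log K / log b.  A cover
    of the set by U_n thus pulls back to a cover of [0, 1[ by sets lying in
    intervals of length at most 2 C (diam U_n)^t, and subadditivity of Lebesgue
    measure bounds the sum of the (diam U_n)^t below by 1 / (2 C). *)
Require Import Defs.
From mathcomp Require Import all_boot all_order all_algebra.
From mathcomp Require Import all_classical all_reals all_analysis.
From mathcomp Require Import ring lra.
Import Order.TTheory GRing.Theory Num.Theory.
Import numFieldNormedType.Exports.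
Local Open Scope classical_set_scope.
Local Open Scope ring_scope.

Lemma diam_ge0 (R : realType) (A : set R) : (0 <= diam A)%E.
Proof. by apply: ereal_sup_ubound; left. Qed.

Lemma diam_pow_ge0 (R : realType) (s : R) (A : set R) : (0 <= diam_pow s A)%E.
Proof. by rewrite /diam_pow; case: pselect => A0 //; exact: poweR_ge0. Qed.

Lemma hausdorff_dim_ge0 (R : realType) (E : set R) : (0 <= hausdorff_dim E)%E.
Proof. by apply: le_ereal_inf_tmp => _ [s [s0 _] <-]; rewrite lee_fin. Qed.

(** * Dimension bound from an inverse Hölder parametrization *)

Section HolderParametrization.
Context {R : realType} (F : R -> R) (t C : R).
Hypothesis C_gt0 : 0 < C.
Hypothesis F_holder : forall y z : R, 0 <= y < 1 -> 0 <= z < 1 ->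
  `|y - z| <= C * `|F y - F z| `^ t.

(** All parameters sent into [A] lie within [C * (diam A)^t] of any one of them, and [diam A <= 1]
    allows the exponent [t] to be lowered to [s]. *)
Lemma preimage_sub_itv (s : R) (A : set R) : 0 <= s -> s < t ->
  (diam A <= 1)%E ->
  exists2 I : interval R, F @^-1` A `&` `[0, 1[ `<=` [set` I] &
    (lebesgue_measure ([set` I] : set R) <= (2 * C)%:E * diam_pow s A)%E.
Proof.
move=> s0 st dA1.
have [[y [Ay y01]]|noA] := pselect (exists y, A (F y) /\ 0 <= y < 1); last first.
  exists `]0, 0[ => [y [Ay]|].
    by rewrite /= in_itv /= => y01; case: noA; exists y.
  rewrite lebesgue_measure_itv /= lte_fin ltxx.
  by rewrite mule_ge0 ?diam_pow_ge0 // lee_fin mulr_ge0 // ltW.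
have dAfin : diam A \is a fin_num.
  by rewrite ge0_fin_numE ?diam_ge0 // (le_lt_trans dA1) ?ltry.
pose D := fine (diam A).
have dAE : diam A = D%:E by rewrite fineK.
have D0 : 0 <= D by rewrite -lee_fin -dAE diam_ge0.
have D1 : D <= 1 by rewrite -lee_fin -dAE.
have FD z : A (F z) -> `|F y - F z| <= D.
  move=> Az; rewrite -lee_fin -dAE; apply: ereal_sup_ubound; right.
  by exists (F y), (F z).
have Dts : D `^ t <= D `^ s.
  (* For [D = 0] the left side vanishes because [t > 0]; the right side may be [0 ^ 0 = 1]. *)
  have [D_eq0|Dneq0] := eqVneq D 0.
    by rewrite D_eq0 powR0 ?powR_ge0 // gt_eqF // (le_lt_trans s0).
  by apply: ger_powR; [rewrite D1 lt_neqAle eq_sym Dneq0 D0|exact: ltW].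
pose r := C * D `^ s.
have r0 : 0 <= r by rewrite mulr_ge0 ?powR_ge0 // ltW.
exists `[y - r, y + r].
  move=> z [Az]; rewrite /= !in_itv /= => z01.
  have : `|z - y| <= r.
    rewrite distrC (le_trans (F_holder _ _ y01 z01)) // ler_pM2l //.
    rewrite (le_trans _ Dts) // ge0_ler_powR ?nnegrE //; last exact: FD.
    exact: le_trans (ltW st).
  by rewrite ler_distl.
have -> : diam_pow s A = (D `^ s)%:E.
  rewrite /diam_pow; case: pselect => [A0|nA0]; first by exfalso; rewrite A0 in Ay.
  by rewrite dAE poweR_EFin.
rewrite lebesgue_measure_itv /= -EFinM; case: ifPn => _.
  by rewrite -EFinB lee_fin -mulrA -/r; lra.
by rewrite lee_fin -mulrA -/r mulr_ge0.
Qed.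

(** An exponent [s < t] of measure zero is refuted: every cover at scale 1 has [s]-sum at least
    [1 / (2 C)]. *)
Lemma hausdorff_dim_ge_holder (E : set R) :
  (forall y, 0 <= y < 1 -> E (F y)) -> (t%:E <= hausdorff_dim E)%E.
Proof.
move=> FE; apply: le_ereal_inf_tmp => _ [s [s0 Hs0] <-].
rewrite lee_fin leNgt; apply/negP => st.
suff : ((2 * C)^-1%:E <= hausdorff_measure s E)%E.
  by rewrite Hs0 lee_fin leNgt invr_gt0 mulr_gt0.
(* Scale 1 suffices: [preimage_sub_itv] only asks for diameters at most 1. *)
apply: (@le_trans _ _ (hausdorff_premeasure s 1 E)); last first.
  by apply: ereal_sup_ubound; exists 1 => //=.
apply: le_ereal_inf_tmp => _ [U [dU EU] <-].
have /choice[I HI] : forall n, exists I : interval R,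
    F @^-1` (U n) `&` `[0, 1[ `<=` [set` I] /\
    (lebesgue_measure ([set` I] : set R) <= (2 * C)%:E * diam_pow s (U n))%E.
  by move=> n; have [I] := preimage_sub_itv _ _ s0 st (dU n); exists I.
have cover01 : `[0, 1[ `<=` \bigcup_n ([set` I n] : set R).
  move=> y y01; have [n _ Uy] : (\bigcup_n U n) (F y).
    by apply/EU/FE; move: y01; rewrite /= in_itv.
  by exists n => //; apply: (HI n).1.
have le1 := @measure_sigma_subadditive _ _ _ (@lebesgue_measure R) (`[0, 1[%classic : set R)
  (fun n => [set` I n]) (fun n => measurable_itv _) (measurable_itv _) cover01.
have m01 : lebesgue_measure (`[0, 1[%classic : set R) = 1%E.
  by rewrite lebesgue_measure_itv /= lte_fin ltr01 sube0.
have C2 : 0 < 2 * C by rewrite mulr_gt0.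
have : (1 <= (2 * C)%:E * \sum_(0 <= n <oo) diam_pow s (U n))%E.
  rewrite -[leLHS]m01; apply: (le_trans le1); rewrite -nneseriesZl; last first.
    by move=> n _; exact: diam_pow_ge0.
  by apply: lee_nneseries => [n _ _|n _]; [exact: measure_ge0|exact: (HI n).2].
by rewrite muleC -lee_pdivrMr // mul1e.
Qed.

End HolderParametrization.

Lemma geometric_tail_le (R : realFieldType) (b M : R) (a : nat -> R) (n N : nat) :
  1 < b -> (forall i, (n < i)%N -> `|a i| <= M) ->
  `|\sum_(n.+1 <= i < N) a i / b ^+ i| <= M / (b - 1) / b ^+ n.
Proof.
move=> b1 aM.
have b0 : 0 < b by apply: lt_trans b1.
have M0 : 0 <= M by apply: le_trans (aM n.+1 _).
have bn k : 0 < b ^+ k by rewrite exprn_gt0.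
have c0 : 0 <= M / (b - 1) by rewrite divr_ge0 // subr_ge0 ltW.
have [Nn|nN] := leqP N n.+1.
  by rewrite big_geq // normr0 divr_ge0 // ltW.
(* The subtracted term makes the bound telescope, so that induction on the number of terms goes
   through. *)
suff H k : `|\sum_(n.+1 <= i < n.+1 + k) a i / b ^+ i| <=
    M / (b - 1) / b ^+ n - M / (b - 1) / b ^+ (n + k).
  rewrite -(subnKC (ltnW nN)) (le_trans (H _)) // gerBl.
  by rewrite divr_ge0 // ltW.
elim: k => [|k IH]; first by rewrite !addn0 big_geq // normr0 subrr.
rewrite addnS big_nat_recr ?leq_addr //= (le_trans (ler_normD _ _)) //.
rewrite normrM normfV (ger0_norm (ltW (bn _))).
have le2 : `|a (n.+1 + k)%N| / b ^+ (n.+1 + k) <= M / b ^+ (n.+1 + k).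
  by rewrite ler_pM2r ?invr_gt0 // aM // addSn ltnS leq_addr.
apply: (le_trans (lerD IH le2)).
rewrite addSn addnS exprS.
suff -> : M / (b * b ^+ (n + k)) =
  M / (b - 1) / b ^+ (n + k) - M / (b - 1) / (b * b ^+ (n + k)) by lra.
field; rewrite !gt_eqF ?subr_gt0 //; exact: bn.
Qed.

(** * Separation of sums whose digits differ *)

Section ReciprocalDigits.
Context {R : realType} {b : R} {K : nat}.
Hypotheses (b_gt1 : 1 < b) (K_gt1 : (1 < K)%N) (Kb : K%:R ^+ 2 < b).

Let bX_gt0 n : 0 < b ^+ n.
Proof. by rewrite exprn_gt0 // (lt_trans ltr01). Qed.

Lemma reciprocal_digit_dist_le (p q : nat) :
  (1 <= p <= K)%N -> (1 <= q <= K)%N ->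
  `|p%:R^-1 - q%:R^-1| <= 1 - K%:R^-1 :> R.
Proof.
have inv_itv d : (1 <= d <= K)%N -> K%:R^-1 <= (d%:R^-1 : R) <= 1.
  move=> /andP[d1 dK].
  have K0 : (0 < K)%N by apply: leq_trans dK.
  apply/andP; split; first by rewrite lef_pV2 ?posrE ?ltr0n // ler_nat.
  by rewrite invf_le1 ?ler1n ?ltr0n.
move=> /inv_itv /andP[? ?] /inv_itv /andP[? ?].
by rewrite ler_norml; apply/andP; split; lra.
Qed.

(** For [p < q <= K] the difference is [(q - p) / (p q)], with [q - p >= 1] and [p <= K - 1]. *)
Lemma reciprocal_digit_dist_ge (p q : nat) :
  (1 <= p <= K)%N -> (1 <= q <= K)%N -> p != q ->
  (K%:R * (K%:R - 1))^-1 <= `|p%:R^-1 - q%:R^-1| :> R.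
Proof.
wlog pq : p q / (p < q)%N.
  move=> H pK qK pq; have [?|?|pq'] := ltngtP p q; first exact: H.
  - by rewrite distrC; apply: H => //; rewrite eq_sym.
  - by rewrite pq' eqxx in pq.
move=> /andP[p1 pK] /andP[q1 qK] _.
have p0 : 0 < p%:R :> R by rewrite ltr0n.
have q0 : 0 < q%:R :> R by rewrite ltr0n.
have pq1 : 1 <= q%:R - p%:R :> R by rewrite -natrB ?(ltnW pq) // ler1n subn_gt0.
have -> : p%:R^-1 - q%:R^-1 = (q%:R - p%:R) / (p%:R * q%:R) :> R.
  by field; rewrite !gt_eqF.
have pqK : p%:R * q%:R <= K%:R * (K%:R - 1) :> R.
  rewrite mulrC ler_pM ?(ltW p0) ?(ltW q0) ?ler_nat //.
  have : q%:R <= K%:R :> R by rewrite ler_nat.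
  by lra.
rewrite normrM normfV !gtr0_norm ?mulr_gt0 //; last by lra.
have pq0 : 0 < p%:R * q%:R :> R by rewrite mulr_gt0.
have K0 : 0 < K%:R * (K%:R - 1) :> R by apply: lt_le_trans pqK.
rewrite -[leLHS]mul1r ler_pM ?invr_ge0 ?(ltW K0) //.
by rewrite lef_pV2.
Qed.

Definition partial_sum (d : nat -> nat) (N : nat) : R :=
  \sum_(1 <= n < N) ((d n)%:R * b ^+ n)^-1.

Lemma is_cvg_partial_sum (d : nat -> nat) : (forall n, (1 <= d n <= K)%N) ->
  cvgn (partial_sum d).
Proof.
move=> dK; apply: nondecreasing_is_cvgn.
  apply/nondecreasing_seqP => n; rewrite /partial_sum.
  case: n => [|n]; first by rewrite !big_geq.
  by rewrite [leRHS]big_nat_recr //= lerDl invr_ge0 mulr_ge0 // ltW.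
exists (1 / (b - 1) / b ^+ 0) => _ [N _ <-]; apply: (le_trans (ler_norm _)).
rewrite /partial_sum.
under eq_bigr do rewrite invfM.
apply: geometric_tail_le => // i _.
have /andP[d1 _] := dK i.
by rewrite ger0_norm ?invr_ge0 // invf_le1 ?ltr0n // ler1n.
Qed.

(* Least gap between two reciprocal digits, minus the largest possible
   contribution of all later terms (both in units of b^-n). *)
Definition separation : R :=
  (K%:R * (K%:R - 1))^-1 - (1 - K%:R^-1) / (b - 1).

Lemma separation_gt0 : 0 < separation.
Proof.
have K2 : 2 <= K%:R :> R by rewrite ler_nat.
have K0 : 0 < K%:R :> R by lra.
have K1 : 0 < K%:R - 1 :> R by lra.
have b1 : 0 < b - 1 by rewrite subr_gt0.
(* The numerator is positive: it equals [(b - K^2) + 2 (K - 1)]. *)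
have -> : separation = (b - 1 - (K%:R - 1) ^+ 2) / (K%:R * (K%:R - 1) * (b - 1)).
  by rewrite /separation; field; rewrite !gt_eqF.
have Kb0 : 0 < b - K%:R ^+ 2 by rewrite subr_gt0.
by rewrite divr_gt0 ?mulr_gt0 //; nra.
Qed.

Lemma partial_sum_separated (d e : nat -> nat) (n : nat) :
  (forall i, (1 <= d i <= K)%N) -> (forall i, (1 <= e i <= K)%N) ->
  (0 < n)%N -> (forall i, (0 < i < n)%N -> d i = e i) -> d n != e n ->
  separation / b ^+ n <= `|limn (partial_sum d) - limn (partial_sum e)|.
Proof.
move=> dK eK n0 de dne.
have cvgde : `|partial_sum d N - partial_sum e N| @[N --> \oo] -->
    `|limn (partial_sum d) - limn (partial_sum e)|.
  by apply: cvg_norm; apply: cvgB; exact: is_cvg_partial_sum.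
(* It is enough to bound the partial sums with [N > n]: terms before [n] cancel, and the tail is at
   most geometric. *)
apply: (cvgr_to_ge cvgde); near=> N.
have nN : (n < N)%N by near: N; exact: nbhs_infty_gt.
pose a i : R := (d i)%:R^-1 - (e i)%:R^-1.
have -> : partial_sum d N - partial_sum e N =
    a n / b ^+ n + \sum_(n.+1 <= i < N) a i / b ^+ i.
  rewrite /partial_sum -sumrB (eq_bigr (fun i => a i / b ^+ i)); last first.
    by move=> i _; rewrite !invfM -mulrBl.
  rewrite (big_cat_nat n0 (ltnW nN)) /= big_nat big1 ?add0r.
    by rewrite big_ltn.
  by move=> i /de ein; rewrite /a ein subrr mul0r.
apply: le_trans (lerB_normD _ _).
rewrite normrM normfV (gtr0_norm (bX_gt0 n)) /separation mulrBl lerB //.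
  by rewrite ler_pM2r ?invr_gt0 // reciprocal_digit_dist_ge.
by apply: geometric_tail_le => // i _; exact: reciprocal_digit_dist_le.
Unshelve. all: by end_near. Qed.

(** * Base-[K] digits of points of [0, 1[ *)

Lemma truncn_natM_div (x : R) : 0 <= x ->
  (Num.truncn (K%:R * x) %/ K = Num.truncn x)%N.
Proof.
move=> x0; have K0 : (0 < K)%N by apply: ltnW.
have Kx0 : 0 <= K%:R * x by rewrite mulr_ge0.
apply/eqP; rewrite eq_sym truncn_eq //.
rewrite -(ler_pM2l (_ : 0 < K%:R)) ?ltr0n //.
rewrite -(ltr_pM2l (_ : 0 < K%:R)) ?ltr0n //.
rewrite -!natrM -truncn_ge_nat // -truncn_lt_nat //.
by rewrite mulnC leq_divM /= mulnC ltn_ceil.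
Qed.

(* The base-K digit of y, shifted into the range 1, ..., K. *)
Definition digit (y : R) (n : nat) : nat :=
  (Num.truncn (K%:R ^+ n * y) %% K).+1.

Lemma digit_itv (y : R) (n : nat) : (1 <= digit y n <= K)%N.
Proof. by rewrite /digit ltn_pmod // ltnW. Qed.

(** Induction on [n]: the quotient by [K] of the truncation at level [n + 1] is the truncation at
    level [n], and the remainder is the new digit. *)
Lemma truncn_eq_of_digits (y z : R) (n : nat) : 0 <= y < 1 -> 0 <= z < 1 ->
  (forall i, (0 < i <= n)%N -> digit y i = digit z i) ->
  Num.truncn (K%:R ^+ n * y) = Num.truncn (K%:R ^+ n * z).
Proof.
move=> /andP[y0 y1] /andP[z0 z1]; elim: n => [|n IH] dyz.
  by rewrite !expr0 !mul1r !(@truncn_def _ _ 0) ?mulr0n ?y0 ?z0.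
rewrite (divn_eq (Num.truncn _) K) [RHS](divn_eq _ K).
rewrite {1 3}exprS -!mulrA !truncn_natM_div ?mulr_ge0 ?exprn_ge0 //.
have [<-] := dyz n.+1 (leqnn _).
rewrite IH // => i /andP[i0 ni]; apply: dyz.
by rewrite i0 leqW.
Qed.

Lemma dist_eq_digits (y z : R) (n : nat) : 0 <= y < 1 -> 0 <= z < 1 ->
  (forall i, (0 < i <= n)%N -> digit y i = digit z i) ->
  `|y - z| <= (K%:R ^+ n)^-1.
Proof.
move=> y01 z01 /(truncn_eq_of_digits _ _ _ y01 z01) yz.
have Kn : 0 < K%:R ^+ n :> R by rewrite exprn_gt0 // ltr0n ltnW.
have H (x : R) : 0 <= x < 1 -> (Num.truncn (K%:R ^+ n * x))%:R <= K%:R ^+ n * x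
    < (Num.truncn (K%:R ^+ n * x)).+1%:R.
  move=> /andP[x0 _]; apply: truncn_itv.
  by rewrite mulr_ge0 // ltW.
(* [K^n y] and [K^n z] share a unit interval with integer endpoints. *)
have := H _ y01; have := H _ z01; rewrite yz -natr1 => /andP[? ?] /andP[? ?].
rewrite -(ler_pM2l Kn) divff ?gt_eqF // -{1}(gtr0_norm Kn) -normrM mulrBr.
by rewrite ler_norml; apply/andP; split; lra.
Qed.

Lemma exists_digit_neq (y z : R) : 0 <= y < 1 -> 0 <= z < 1 -> y != z ->
  exists n, (0 < n)%N && (digit y n != digit z n).
Proof.
move=> y01 z01; apply: contra_neqP => nex.
apply/eqP; rewrite -subr_eq0 -normr_le0 leNgt; apply/negP => yz0.
(* With this [n], [K^n >= 2^n > 1 / |y - z|], against the bound for points with equal digits. *)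
pose n := Num.bound (`|y - z|^-1).
have : `|y - z| <= (K%:R ^+ n)^-1.
  apply: dist_eq_digits => // i /andP[i0 _]; apply/eqP/negPn/negP => di.
  by apply: nex; exists i; rewrite i0.
apply/negP; rewrite -ltNge invf_plt ?posrE ?exprn_gt0 ?ltr0n ?(ltnW K_gt1) //.
rewrite (lt_le_trans (upper_nthrootP (leqnn _))) //.
by rewrite lerXn2r ?nnegrE ?ler_nat.
Qed.

(** * The parametrization and its Hölder estimate *)

Definition reciprocal_map (y : R) : R := limn (partial_sum (digit y)).

Lemma reciprocal_map_holder (y z : R) : 0 <= y < 1 -> 0 <= z < 1 ->
  `|y - z| <= K%:R / separation `^ (ln K%:R / ln b) *
    `|reciprocal_map y - reciprocal_map z| `^ (ln K%:R / ln b).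
Proof.
move=> y01 z01; set t := ln K%:R / ln b; have c0 := separation_gt0.
have [->|yz] := eqVneq y z.
  by rewrite subrr normr0 mulr_ge0 ?divr_ge0 ?powR_ge0.
have ex := exists_digit_neq _ _ y01 z01 yz.
case: (ex_minnP ex) => n /andP[n0 dn] nmin.
have deq i : (0 < i < n)%N -> digit y i = digit z i.
  move=> /andP[i0 ilt]; apply/eqP/negPn/negP => di.
  by have := nmin i; rewrite i0 di leqNgt ilt => /(_ isT).
have b0 : 0 < b by apply: lt_trans b_gt1.
(* This identity dictates the exponent: it turns [b^(-n)] to the power [t] into [K^(-n)]. *)
have bt : b `^ t = K%:R.
  rewrite /powR gt_eqF // /t divfK ?lnK ?posrE ?ltr0n ?(ltnW K_gt1) //.
  by rewrite gt_eqF // ln_gt0.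
have t0 : 0 <= t by rewrite divr_ge0 // ?ln_ge0 ?ler1n ?(ltnW K_gt1) // ltW.
have sep : (separation / b ^+ n) `^ t <=
    `|reciprocal_map y - reciprocal_map z| `^ t.
  have sb0 : 0 <= separation / b ^+ n by rewrite divr_ge0 // ltW.
  rewrite ge0_ler_powR ?nnegrE //.
  by apply: partial_sum_separated => // i; exact: digit_itv.
have btn : (b ^+ n)^-1 `^ t = (K%:R ^+ n)^-1.
  by rewrite -powR_invn ?(ltW b0) // -powRrM mulrC powRrM bt powR_invn.
rewrite powRM ?invr_ge0 ?(ltW c0) ?(ltW (bX_gt0 _)) // btn in sep.
rewrite mulrAC ler_pdivlMr ?powR_gt0 //.
have K0 : 0 < K%:R :> R by rewrite ltr0n ltnW.
(* Only the first [n - 1] digits agree; the lost factor [K] is the one in the Hölder constant. *)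
apply: (@le_trans _ _ ((K%:R ^+ n.-1)^-1 * separation `^ t)).
  rewrite ler_wpM2r ?powR_ge0 // dist_eq_digits // => i /andP[i0 ni].
  by apply: deq; rewrite i0 -(prednK n0) ltnS.
rewrite -(ler_pM2l K0) in sep; apply: le_trans sep.
rewrite -{2}(prednK n0) exprS invfM mulrCA [K%:R * (_ * _)]mulrA divff ?gt_eqF //.
by rewrite mul1r mulrC.
Qed.

End ReciprocalDigits.

Theorem theorem2 (R : realType) (b : R) (K : nat) (hb : 4 < b)
    (hK : (0 < K)%N) (hKb : K%:R ^+ 2 < b) :
  ((ln K%:R / ln b)%:E <= hausdorff_dim (reciprocal_digit_set b K))%E.
Proof.
have b1 : 1 < b by lra.
(* For [K = 1] the claimed bound is 0; the separation argument needs two distinct digits. *)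
have [K1|K1] := leqP K 1.
  have -> : K = 1%N by apply/eqP; rewrite eqn_leq K1.
  by rewrite ln1 mul0r; exact: hausdorff_dim_ge0.
have c0 := separation_gt0 b1 K1 hKb.
apply: (hausdorff_dim_ge_holder (@reciprocal_map R b K) _
  (K%:R / @separation R b K `^ (ln K%:R / ln b))).
- by rewrite divr_gt0 ?ltr0n // powR_gt0.
- by move=> y z y01 z01; exact: reciprocal_map_holder.
- move=> y _; exists (digit (K := K) y); split=> [n _|]; first exact: digit_itv.
  by apply: is_cvg_partial_sum => // n; exact: digit_itv.
Qed.
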